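(* Let $k\in\{1,2,3,4\}$, let $n\ge 0$, let $\tau_{n+1}>0$ be an arbitrary time step, and consider one step of the R-IMEX-BDF$k$ scheme described in the context, producing from the previous data (in particular from $r^n$) the quantities $\tilde\phi^{n+1},\tilde{\mathbf u}^{n+1},\tilde r^{n+1},\xi_k^{n+1},\zeta_k^{n+1},\phi^{n+1},\mathbf u^{n+1}$ (Step 1), followed by the relaxation (Step 2) $$r^{n+1}=\sigma_0^{n+1}\tilde r^{n+1}+(1-\sigma_0^{n+1})E_1(\phi^{n+1}).$$ Write $\tilde\kappa=\kappa(\tilde\phi^{n+1},\tilde{\mathbf u}^{n+1})$, $\kappa^{n+1}=\kappa(\phi^{n+1},\mathbf u^{n+1})$, $\tilde E_1=E_1(\tilde\phi^{n+1})$, $E_1^{n+1}=E_1(\phi^{n+1})$. Choose $\sigma_0^{n+1}$ and $\delta^{n+1}$ as follows. 1. If $\tilde r^{n+1}=E_1^{n+1}$, set $\sigma_0^{n+1}=0$ and $\delta^{n+1}=\dfrac{\tilde r^{n+1}\,\tilde\kappa}{\tilde E_1\,\kappa^{n+1}}$. 2. If $\tilde r^{n+1}>E_1^{n+1}$, set $\sigma_0^{n+1}=0$ and $\delta^{n+1}=\dfrac{\tilde r^{n+1}-E_1^{n+1}}{\tau_{n+1}\kappa^{n+1}}+\dfrac{\tilde r^{n+1}\,\tilde\kappa}{\tilde E_1\,\kappa^{n+1}}$. 3. If $\tilde r^{n+1}<E_1^{n+1}$ and $\tilde r^{n+1}-E_1^{n+1}+\tau_{n+1}\dfrac{\tilde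 r^{n+1}}{\tilde E_1}\tilde\kappa\ge 0$, set $\sigma_0^{n+1}=0$ and $\delta^{n+1}=\dfrac{\tilde r^{n+1}-E_1^{n+1}}{\tau_{n+1}\kappa^{n+1}}+\dfrac{\tilde r^{n+1}\,\tilde\kappa}{\tilde E_1\,\kappa^{n+1}}$. 4. If $\tilde r^{n+1}<E_1^{n+1}$ and $\tilde r^{n+1}-E_1^{n+1}+\tau_{n+1}\dfrac{\tilde r^{n+1}}{\tilde E_1}\tilde\kappa< 0$, set $\sigma_0^{n+1}=1-\dfrac{\tau_{n+1}\,\tilde r^{n+1}\,\tilde\kappa}{\tilde E_1\,(E_1^{n+1}-\tilde r^{n+1})}$ and $\delta^{n+1}=0$. Then $\sigma_0^{n+1}\in\Gamma$, where $\Gamma$ is the set $$\Gamma=\Big\{\sigma\in[0,1]\ :\ \frac{r-\tilde r^{n+1}}{\tau_{n+1}}=-\delta^{n+1}\kappa^{n+1}+\frac{\tilde r^{n+1}}{\tilde E_1}\tilde\kappa\ \text{ with } r=\sigma\tilde r^{n+1}+(1-\sigma)E_1^{n+1}\Big\}.$$ Moreover, given $r^n\ge 0$, one has $r^{n+1}\ge 0$ and $\xi_k^{n+1}\ge 0$, and the scheme is unconditionally energy stable in the sense that $$r^{n+1}-r^n=-\tau_{n+1}\,\delta^{n+1}\,\kappa(\phi^{n+1},\mathbf u^{n+1})\le 0\qquad\text{for all } n\ge 0.$$ Furthermore, $r^{n+1}\le E_1(\phi^{n+1})$ for all $n\ge 0$.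
   Context: Continuous model (Cahn–Hilliard–Brinkman system). Let $\Omega\subset\mathbb R^d$ ($d=2,3$) with periodic boundary conditions. The unknowns are the phase function $\phi$, chemical potential $\mu$, velocity $\mathbf u$ and pressure $p$, satisfying $$\phi_t=\nabla\cdot(M(\phi)\nabla\mu)-\nabla\cdot(\mathbf u\phi),\quad \mu=-\varepsilon^2\Delta\phi+F'(\phi),$$ $$-\nabla\cdot[\nu(\phi)D(\mathbf u)]+\eta(\phi)\mathbf u=-\nabla p-\gamma\phi\nabla\mu,\quad \nabla\cdot\mathbf u=0,$$ where $F(\phi)=\frac14(\phi^2-1)^2$, $D(\mathbf u)=\nabla\mathbf u+\nabla\mathbf u^T$, $\varepsilon>0$ is the interface thickness, $\gamma>0$ the surface tension parameter, and the mobility $M(\phi)$, viscosity $\nu(\phi)$ and permeability $\eta(\phi)$ are positive functions. Energy and dissipation functionals. $E(\phi)=\int_\Omega\big(\frac{\varepsilon^2}{2}|\nabla\phi|^2+F(\phi)\big)dx$, $E_1(\phi)=E(\phi)+C_0$ with a constant $C_0\ge 0$, and $$\kappa(\phi,\mathbf u)=\int_\Omega \Big(M(\phi)|\nabla\mu|^2+\frac1\gamma\eta(\phi)|\mathbf u|^2+\frac1{2\gamma}\nu(\phi)|D(\mathbf u)|^2\Big)dx,$$ where $\mu=-\varepsilon^2\Delta\phi+F'(\phi)$ is the chemical potential associated with $\phi$. Time discretization. Time levels $t_0<t_1<\dots$ have variable steps $\tau_{n+1}=t_{n+1}-t_n>0$. The number $\alpha_k$ and the operators $A_k,B_k$ are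 those of the variable-step $k$-th order BDF formula and $k$-th order extrapolation: $\frac{\alpha_k\phi(t_{n+1})-A_k(\phi^n)}{\tau_{n+1}}$ is the derivative at $t_{n+1}$ of the polynomial of degree at most $k$ interpolating the values at $t_{n+1},t_n,\dots,t_{n+1-k}$, and $B_k(\phi^n)$ is the value at $t_{n+1}$ of the polynomial of degree at most $k-1$ interpolating the values at $t_n,\dots,t_{n+1-k}$ (likewise for $\mathbf u$ and $\mu$; $\mu^j=-\varepsilon^2\Delta\phi^j+F'(\phi^j)$). The earlier values needed to form these are taken as given. Let $S\ge0$ be a stabilization parameter and $\tilde F'(\phi)=\phi^3-(S+1)\phi$. Scheme R-IMEX-BDF$k$, Step 1. Find $(\tilde\phi^{n+1},\tilde\mu^{n+1},\tilde{\mathbf u}^{n+1},\tilde p^{n+1},\tilde r^{n+1})$ such that $$\frac{\alpha_k\tilde\phi^{n+1}-A_k(\phi^n)}{\tau_{n+1}}=\nabla\cdot\big(M(B_k(\phi^n))\nabla\tilde\mu^{n+1}\big)-\nabla\cdot\big(B_k(\mathbf u^n)B_k(\phi^n)\big),$$ $$\tilde\mu^{n+1}=-\varepsilon^2\Delta\tilde\phi^{n+1}+S\tilde\phi^{n+1}+\tilde F'[B_k(\phi^n)],$$ $$-\nabla\cdot[\nu(B_k(\phi^n))D(\tilde{\mathbf u}^{n+1})]+\eta(B_k(\phi^n))\tilde{\mathbf u}^{n+1}=-\nabla\tilde p^{n+1}-\gamma B_k(\phi^n)\nabla B_k(\mu^n),\qquad \nabla\cdot\tilde{\mathbf u}^{n+1}=0,$$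 $$\frac{\tilde r^{n+1}-r^n}{\tau_{n+1}}=-\frac{\tilde r^{n+1}}{E_1(\tilde\phi^{n+1})}\kappa(\tilde\phi^{n+1},\tilde{\mathbf u}^{n+1}),$$ and set $\xi_k^{n+1}=\dfrac{\tilde r^{n+1}}{E_1(\tilde\phi^{n+1})}$, $\zeta_k^{n+1}=1-(1-\xi_k^{n+1})^{k+1}$, $\phi^{n+1}=\zeta_k^{n+1}\tilde\phi^{n+1}$, $\mathbf u^{n+1}=\zeta_k^{n+1}\tilde{\mathbf u}^{n+1}$, $p^{n+1}=\zeta_k^{n+1}\tilde p^{n+1}$. Step 2 is the relaxation defining $r^{n+1}$ given in the claim, with $\delta^{n+1}\ge0$. The functions produced by the scheme are assumed regular enough for all integrals to be finite, and all quotients that appear are understood to have nonzero denominators (i.e. $E_1(\tilde\phi^{n+1})>0$, and $\kappa(\phi^{n+1},\mathbf u^{n+1})>0$ in Cases 1–3).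
   Formalization: The assumption r^n ≥ 0 is made for all conclusions, including σ_0^{n+1} ∈ Γ; without it the membership fails, since for r^n < 0 and κ̃ > 0 Case 4 gives σ_0^{n+1} > 1. *)

(* Defs.v *)
From HB Require Import structures.
From mathcomp Require Import all_boot all_order all_algebra.
From mathcomp Require Import all_classical all_reals all_analysis.

Set Implicit Arguments.
Unset Strict Implicit.
Unset Printing Implicit Defensive.
Import Order.TTheory GRing.Theory Num.Theory numFieldNormedType.Exports.
Local Open Scope classical_set_scope.
Local Open Scope ring_scope.


(* The library has Lebesgue measure on R and binary product measures only;
   Lebesgue measure on R^d, viewed as d.-tuple, is built by recursion on d as
   the image of lebesgue_measure \x lebesgue_tuple d under tcons. *)
Section LebesgueTuple.
Variable R : realType.
Local Notation RT := (measurableTypeR R).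

Definition tcons d (z : RT * d.-tuple RT) : d.+1.-tuple RT :=
  [tuple of z.1 :: z.2].

Lemma measurable_tcons d : measurable_fun [set: RT * d.-tuple RT] (@tcons d).
Proof. by apply: measurable_cons. Qed.

Section step.
Variables (d : nat) (mu : {sigma_finite_measure set (d.-tuple RT) -> \bar R}).

Definition lebesgue_cons : set (d.+1.-tuple RT) -> \bar R :=
  pushforward (lebesgue_measure \x mu)%E (@tcons d).

Let lebesgue_cons0 : lebesgue_cons set0 = 0%E.
Proof. by rewrite /lebesgue_cons /pushforward preimage_set0 measure0. Qed.

Let lebesgue_cons_ge0 A : (0 <= lebesgue_cons A)%E.
Proof. by rewrite /lebesgue_cons /pushforward; exact: measure_ge0. Qed.

Let lebesgue_cons_sigma_additive : semi_sigma_additive lebesgue_cons.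
Proof. exact: (@measure_semi_sigma_additive _ _ _
  (measure_function_pushforward__canonical__measure_function_Measure
     (lebesgue_measure \x mu)%E (@measurable_tcons d))). Qed.

HB.instance Definition _ := isMeasure.Build _ _ _ lebesgue_cons
  lebesgue_cons0 lebesgue_cons_ge0 lebesgue_cons_sigma_additive.

Let lebesgue_cons_sigma_finite : sigma_finite setT lebesgue_cons.
Proof.
have /sigma_finiteP[F [TF ndF Foo]] := sigma_finiteT (@lebesgue_measure R).
have /sigma_finiteP[G [TG ndG Goo]] := sigma_finiteT mu.
pose h (s : d.+1.-tuple RT) : RT * d.-tuple RT :=
  (tnth s ord0, [tuple of behead s]).
have hK : cancel (@tcons d) h.
  by case=> x s; congr (_, _); apply: val_inj.
have mh : measurable_fun setT h.
  apply/measurable_fun_pairP; split; first exact: measurable_tnth.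
  exact: measurable_behead.
exists (fun i => h @^-1` (F i `*` G i)).
  apply/esym/seteqP; split => // s _.
  have [n _ Fn] : (\bigcup_i F i) (h s).1 by rewrite -TF.
  have [k _ Gk] : (\bigcup_i G i) (h s).2 by rewrite -TG.
  exists (maxn n k) => //; split.
  - by move: Fn; exact/subsetPset/ndF/leq_maxl.
  - by move: Gk; exact/subsetPset/ndG/leq_maxr.
move=> i; have [mF Fi] := Foo i; have [mG Gi] := Goo i; split.
  by rewrite -[X in measurable X]setTI; apply: mh => //; exact: measurableX.
rewrite /lebesgue_cons /pushforward -comp_preimage (_ : h \o _ = id); last first.
  by apply/funext => z; exact: hK.
by rewrite preimage_id product_measure1E// lte_mul_pinfty// ge0_fin_numE.
Qed.

HB.instance Definition _ := Measure_isSigmaFinite.Build _ _ _ lebesgue_cons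
  lebesgue_cons_sigma_finite.

End step.

Fixpoint lebesgue_tuple d : {sigma_finite_measure set (d.-tuple RT) -> \bar R} :=
  if d is d'.+1 then lebesgue_cons (lebesgue_tuple d')
  else \d_([tuple of [::]] : 0.-tuple RT).
End LebesgueTuple.

Section Calculus.
Variables (R : realType) (d : nat).
Implicit Types (f : 'rV[R]_d -> R) (v : 'rV[R]_d -> 'rV[R]_d).

Definition partial (i : 'I_d) f (x : 'rV[R]_d) : R := 'D_(delta_mx 0 i) f x.

Definition grad f (x : 'rV[R]_d) : 'rV[R]_d := \row_i partial i f x.

Definition diverg v (x : 'rV[R]_d) : R :=
  \sum_i partial i (fun y => v y 0 i) x.

Definition laplacian f : 'rV[R]_d -> R := diverg (grad f).

Definition vgrad v (x : 'rV[R]_d) : 'M[R]_d :=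
  \matrix_(i, j) partial j (fun y => v y 0 i) x.

Definition strain v (x : 'rV[R]_d) : 'M[R]_d := vgrad v x + (vgrad v x)^T.

Definition mdiverg (A : 'rV[R]_d -> 'M[R]_d) (x : 'rV[R]_d) : 'rV[R]_d :=
  \row_i \sum_j partial j (fun y => A y i j) x.

(* `|A| on matrices is the sup norm in the library, hence this definition. *)
Definition sqnorm m n (A : 'M[R]_(m, n)) : R := \sum_i \sum_j A i j ^+ 2.

Fixpoint classC (m : nat) f : Prop :=
  continuous f /\
  (if m is m'.+1 then
     forall i, (forall x, derivable f x (delta_mx 0 i)) /\
               classC m' (partial i f)
   else True).

Variable L : 'I_d -> R.

Definition periodic f : Prop :=
  forall (x : 'rV[R]_d) i, f (x + L i *: delta_mx 0 i) = f x.

Definition perC (m : nat) f : Prop := classC m f /\ periodic f.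

(* A fundamental cell of the periodic domain. *)
Definition cell : set (d.-tuple (measurableTypeR R)) :=
  [set s | forall i, 0 <= (tnth s i : R) < L i].

Definition row_of (s : d.-tuple (measurableTypeR R)) : 'rV[R]_d :=
  \row_i (tnth s i : R).

Definition cell_integrable f : Prop :=
  (lebesgue_tuple R d).-integrable cell (fun s => (f (row_of s))%:E).

Definition cell_integral f : R :=
  \int[lebesgue_tuple R d]_(s in cell) f (row_of s).

End Calculus.

Record model (R : realType) (d : nat) := Model {
  side : 'I_d -> R;
  eps : R;
  gam : R;
  C0 : R;
  mob : R -> R;
  visc : R -> R;
  permea : R -> R;
  side_gt0 : forall i, 0 < side i;
  eps_gt0 : 0 < eps;
  gam_gt0 : 0 < gam;
  C0_ge0 : 0 <= C0;
  mob_gt0 : forall s, 0 < mob s;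
  visc_gt0 : forall s, 0 < visc s;
  permea_gt0 : forall s, 0 < permea s }.

Definition potential {R : realType} (s : R) : R := 4^-1 * (s ^+ 2 - 1) ^+ 2.

Definition dpotential_stab {R : realType} (S s : R) : R :=
  s ^+ 3 - (S + 1) * s.

Section Functionals.
Variables (R : realType) (d : nat) (P : model R d).
Implicit Types (phi : 'rV[R]_d -> R) (u : 'rV[R]_d -> 'rV[R]_d).

Definition chem_pot phi (x : 'rV[R]_d) : R :=
  - eps P ^+ 2 * laplacian phi x + derive1 potential (phi x).

Definition energy_density phi (x : 'rV[R]_d) : R :=
  eps P ^+ 2 / 2 * sqnorm (grad phi x) + potential (phi x).

Definition energy phi : R := cell_integral (side P) (energy_density phi).

Definition energy1 phi : R := energy phi + C0 P.

Definition kappa_density phi u (x : 'rV[R]_d) : R :=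
  mob P (phi x) * sqnorm (grad (chem_pot phi) x)
  + (gam P)^-1 * permea P (phi x) * sqnorm (u x)
  + (2 * gam P)^-1 * visc P (phi x) * sqnorm (strain u x).

Definition kappa phi u : R := cell_integral (side P) (kappa_density phi u).

Definition finite_integrals phi u : Prop :=
  cell_integrable (side P) (energy_density phi) /\
  cell_integrable (side P) (kappa_density phi u).

End Functionals.

Section BDF.
Variable R : realType.

(* The polynomial of degree < m with value v j at s j for j < m. *)
Definition interp (m : nat) (s v : nat -> R) : {poly R} :=
  \sum_(j < m) v j *: (tnth (m.-lagrange s) j : {poly R}).

Lemma interp_unique m (s v : nat -> R) (q : {poly R}) :
  (0 < m)%N -> injective s -> (size q <= m)%N ->
  (forall j, (j < m)%N -> q.[s j] = v j) -> interp m s v = q.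
Proof.
move=> m_gt0 s_inj sq qv; rewrite [RHS](lagrange_gen m_gt0 s_inj sq) /interp.
by apply: eq_bigr => j _; rewrite qv // mul_polyC.
Qed.

(* The grid is indexed by int: t j and v j with j < 0 are the starting values
   needed by the multistep formulas when n < k - 1. Only the values from
   index n + 1 - k to n + 1 are ever used at step n. *)
Variables (k : nat) (t : int -> R) (n : nat).

Definition tau : R := t n.+1%:Z - t n%:Z.

Definition bdf_nodes (j : nat) : R := t (n.+1%:Z - j%:Z).

Definition bdf_deriv (v : nat -> R) : R :=
  (interp k.+1 bdf_nodes v)^`().[t n.+1%:Z].

(* tau * bdf_deriv is linear in the nodal values; alphak is its coefficient
   on the new value and - Ak its part on the old ones (see bdfE). *)
Definition alphak : R := tau * bdf_deriv (fun j => (j == 0%N)%:R).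

Definition Ak (v : int -> R) : R :=
  - (tau * bdf_deriv (fun j => if j == 0%N then 0 else v (n.+1%:Z - j%:Z))).

Lemma bdfE (v : int -> R) : tau != 0 ->
  (alphak * v n.+1%:Z - Ak v) / tau =
  bdf_deriv (fun j => v (n.+1%:Z - j%:Z)).
Proof.
move=> tau0; rewrite /Ak /alphak opprK mulrAC -mulrA -mulrDr mulrC mulKf //.
rewrite /bdf_deriv /interp !raddf_sum /= !horner_sum mulr_sumr -big_split /=.
apply: eq_bigr => -[[|j] jk] _ /=; rewrite !derivZ !hornerZ.
  by rewrite mul1r mul0r addr0 subr0.
by rewrite mul0r mulr0 add0r.
Qed.

Definition Bk (v : int -> R) : R :=
  (interp k (fun j => t (n%:Z - j%:Z)) (fun j => v (n%:Z - j%:Z))).[t n.+1%:Z].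

End BDF.

Section Scheme.
Variables (R : realType) (d : nat) (P : model R d).
Local Notation sfield := ('rV[R]_d -> R).
Local Notation vfield := ('rV[R]_d -> 'rV[R]_d).

Record stage := Stage {
  tphi : sfield;
  tmu : sfield;
  tu : vfield;
  tp : sfield;
  tr : R }.

Variables (S : R) (k : nat) (t : int -> R) (n : nat).

Definition Bk_s (f : int -> sfield) : sfield :=
  fun x => Bk k t n (fun j => f j x).

Definition Bk_v (v : int -> vfield) : vfield :=
  fun x => \row_i Bk k t n (fun j => v j x 0 i).

Variables (phi : int -> sfield) (u : int -> vfield).

Let phiB : sfield := Bk_s phi.
Let uB : vfield := Bk_v u.
Let muB : sfield := Bk_s (fun j => chem_pot P (phi j)).

Definition regular_data : Prop :=
  forall j, (j < k)%N ->
    perC (side P) 3 (phi (n%:Z - j%:Z)) /\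
    forall i, perC (side P) 1 (fun x => u (n%:Z - j%:Z) x 0 i).

(* Enough to give every derivative in step1 its classical meaning; the
   fluxes are regular as a whole since mob and visc are only positive. *)
Record regular_stage (s : stage) : Prop := RegularStage {
  reg_phi : perC (side P) 3 (tphi s);
  reg_mu : perC (side P) 1 (tmu s);
  reg_flux : forall i,
    perC (side P) 1 (fun x => mob P (phiB x) * grad (tmu s) x 0 i);
  reg_u : forall i, perC (side P) 1 (fun x => tu s x 0 i);
  reg_stress : forall i j,
    perC (side P) 1 (fun x => visc P (phiB x) * strain (tu s) x i j);
  reg_p : perC (side P) 1 (tp s) }.

Record step1 (rn : R) (s : stage) : Prop := Step1 {
  step1_phi : forall x,
    (alphak k t n * tphi s x - Ak k t n (fun j => phi j x)) / tau t n =
    diverg (fun y => mob P (phiB y) *: grad (tmu s) y) x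
    - diverg (fun y => phiB y *: uB y) x;
  step1_mu : forall x,
    tmu s x = - eps P ^+ 2 * laplacian (tphi s) x + S * tphi s x
              + dpotential_stab S (phiB x);
  step1_u : forall x,
    - mdiverg (fun y => visc P (phiB y) *: strain (tu s) y) x
    + permea P (phiB x) *: tu s x =
    - grad (tp s) x - (gam P * phiB x) *: grad muB x;
  step1_div : forall x, diverg (tu s) x = 0;
  step1_r :
    (tr s - rn) / tau t n =
    - (tr s / energy1 P (tphi s)) * kappa P (tphi s) (tu s) }.

Definition xi (s : stage) : R := tr s / energy1 P (tphi s).

Definition zeta (s : stage) : R := 1 - (1 - xi s) ^+ k.+1.

Variable p : int -> sfield.

Record update (s : stage) : Prop := Update {
  update_phi : phi n.+1%:Z = (fun x => zeta s * tphi s x);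
  update_u : u n.+1%:Z = (fun x => zeta s *: tu s x);
  update_p : p n.+1%:Z = (fun x => zeta s * tp s x) }.

End Scheme.

(* rt, kt, Et are the values of r, kappa, E_1 at the output of step1 (tilde
   quantities); kn and En are kappa and E_1 at the updated fields. *)
Section Relaxation.
Variables (R : realType) (tau rt kt kn Et En : R).

Definition case1 : Prop := rt = En.
Definition case2 : Prop := rt > En.
Definition case3 : Prop := rt < En /\ rt - En + tau * (rt / Et) * kt >= 0.
Definition case4 : Prop := rt < En /\ rt - En + tau * (rt / Et) * kt < 0.

Record relaxation_choice (sigma delta : R) : Prop := RelaxationChoice {
  choice1 : case1 -> sigma = 0 /\ delta = (rt * kt) / (Et * kn);
  choice2 : case2 -> sigma = 0 /\
    delta = (rt - En) / (tau * kn) + (rt * kt) / (Et * kn);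
  choice3 : case3 -> sigma = 0 /\
    delta = (rt - En) / (tau * kn) + (rt * kt) / (Et * kn);
  choice4 : case4 ->
    sigma = 1 - (tau * rt * kt) / (Et * (En - rt)) /\ delta = 0 }.

Definition Gamma (delta : R) : set R :=
  [set sigma | 0 <= sigma <= 1 /\
    let r := sigma * rt + (1 - sigma) * En in
    (r - rt) / tau = - (delta * kn) + rt / Et * kt].

End Relaxation.

(* Main.v *)
Require Import Defs.
From HB Require Import structures.
From mathcomp Require Import all_boot all_order all_algebra.
From mathcomp Require Import all_classical all_reals all_analysis.
From mathcomp Require Import ring lra.
Import Order.TTheory GRing.Theory Num.Theory numFieldNormedType.Exports.
Local Open Scope classical_set_scope.
Local Open Scope ring_scope.

(** Stability is a statement about real numbers, resting on three facts
about the step.  Both the energy and the dissipation are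
integrals of nonnegative functions ([energy1_ge0], [kappa_ge0]).  The auxiliary
variable solves a scalar implicit Euler equation with decay rate
[kt / Et >= 0], so it stays nonnegative ([implicit_euler_ge0]).  And
the relaxation equation defining [Gamma] is designed so that, added to the
Euler equation, it cancels the explicit dissipation [rt / Et * kt] and leaves
[r n.+1 - r n = - tau * delta * kn] ([relaxation_telescope]).

It then remains to see what the four cases achieve.  Put
[w := tau * (rt / Et) * kt >= 0], the amount lost in the Euler step.  The
relaxed value may be raised from [rt] by at most [w] without exceeding [r n].
When [En <= rt + w] (cases 1 to 3) the target [En] itself is reachable, and
[delta] records the dissipation left over; otherwise (case 4) all of [w] is
spent, [delta = 0] and the relaxed value [rt + w = r n] is still below [En].
Either way it is at most [En], and it is nonnegative, being [En] or [r n]. *)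

(** * Nonnegativity of the energy and of the dissipation *)

Lemma sqnorm_ge0 (R : realType) m n (A : 'M[R]_(m, n)) : 0 <= sqnorm A.
Proof. by rewrite /sqnorm; do 2![apply: sumr_ge0 => ? _]; exact: sqr_ge0. Qed.

Lemma cell_integral_ge0 (R : realType) d (L : 'I_d -> R) (f : 'rV[R]_d -> R) :
  (forall x, 0 <= f x) -> 0 <= cell_integral L f.
Proof. by move=> f_ge0; apply: Rintegral_ge0 => x _; exact: f_ge0. Qed.

Lemma energy1_ge0 (R : realType) d (P : model R d) phi : 0 <= energy1 P phi.
Proof.
rewrite addr_ge0 ?C0_ge0//; apply: cell_integral_ge0 => x.
apply: addr_ge0; first by rewrite mulr_ge0 ?sqnorm_ge0// divr_ge0// sqr_ge0.
by rewrite mulr_ge0 ?sqr_ge0// invr_ge0.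
Qed.

Lemma kappa_ge0 (R : realType) d (P : model R d) phi u : 0 <= kappa P phi u.
Proof.
apply: cell_integral_ge0 => x; have g0 := ltW (gam_gt0 P).
rewrite /kappa_density !addr_ge0// mulr_ge0 ?sqnorm_ge0//.
- exact/ltW/mob_gt0.
- by rewrite mulr_ge0 ?invr_ge0//; exact/ltW/permea_gt0.
- by rewrite mulr_ge0 ?invr_ge0 ?mulr_ge0//; exact/ltW/visc_gt0.
Qed.

(** * The scalar relaxation *)

Section ScalarRelaxation.
Variables (R : realType) (tau rn rt kt Et : R).
Hypotheses (tau_gt0 : 0 < tau) (kt_ge0 : 0 <= kt) (Et_gt0 : 0 < Et).

Let w := tau * (rt / Et) * kt.

Section ImplicitEuler.
Hypothesis euler : (rt - rn) / tau = - (rt / Et) * kt.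

(** The Euler equation reads [rn = rt * (1 + tau * kt / Et)], with a positive
factor. *)
Lemma implicit_euler_ge0 : 0 <= rn -> 0 <= rt.
Proof.
have -> : rn = rt * (1 + tau * kt / Et).
  have -> : rn = rt - tau * ((rt - rn) / tau) by field; rewrite gt_eqF.
  by rewrite euler; field; rewrite gt_eqF.
by rewrite pmulr_lge0// ltr_pwDl// !mulr_ge0 ?invr_ge0// ltW.
Qed.

Lemma relaxation_telescope (r D : R) :
  (r - rt) / tau = - D + rt / Et * kt -> r - rn = - (tau * D).
Proof.
move=> relax.
have -> : r - rn = tau * ((r - rt) / tau + (rt - rn) / tau).
  by field; rewrite gt_eqF.
by rewrite relax euler; ring.
Qed.

End ImplicitEuler.

Section Choice.
Variables kn En : R.
Hypothesis rt_ge0 : 0 <= rt.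

(** With [sigma = 0] the relaxed value is [En], and the formula for [delta] is
the relaxation equation solved for [delta].  It amounts to
[tau * kn * delta = rt + w - En]: what the Euler step lost beyond reaching
[En] is dissipated. *)
Lemma relaxation_reaches_energy : 0 < kn -> 0 <= rt - En + w ->
  let delta := (rt - En) / (tau * kn) + (rt * kt) / (Et * kn) in
  Gamma tau rt kt kn Et En delta 0 /\ 0 <= delta.
Proof.
move=> kn_gt0 reach delta.
have [nz_tau nz_Et nz_kn] : [/\ tau != 0, Et != 0 & kn != 0].
  by rewrite !gt_eqF.
split; first split; first by rewrite lexx ler01.
- by rewrite /delta /=; field; rewrite nz_kn nz_Et nz_tau.
- have -> : delta = (rt - En + w) / (tau * kn).
    by rewrite /delta /w; field; rewrite nz_kn nz_Et nz_tau.
  by rewrite divr_ge0// mulr_ge0// ltW.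
Qed.

(** In case 4 the loss [w] is smaller than the gap [En - rt], so
[1 - sigma = w / (En - rt)] is a proportion, and it moves [rt] towards [En]
by exactly [w]. *)
Lemma relaxation_stops_short : case4 tau rt kt Et En ->
  let sigma := 1 - (tau * rt * kt) / (Et * (En - rt)) in
  Gamma tau rt kt kn Et En 0 sigma /\ sigma * rt + (1 - sigma) * En < En.
Proof.
move=> [rtEn short] sigma; rewrite -/w in short.
have gap_gt0 : 0 < En - rt by rewrite subr_gt0.
have [nz_tau nz_Et nz_gap] : [/\ tau != 0, Et != 0 & En - rt != 0].
  by rewrite !gt_eqF.
have sigmaE : sigma = 1 - w / (En - rt).
  by rewrite /sigma /w; field; rewrite nz_gap nz_Et.
have rE : sigma * rt + (1 - sigma) * En = rt + w by rewrite sigmaE; field.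
have w_ge0 : 0 <= w by rewrite !mulr_ge0 ?invr_ge0// ltW.
split; last by rewrite rE; lra.
split.
  rewrite sigmaE subr_ge0 ler_pdivrMr// mul1r gerBl divr_ge0 ?(ltW gap_gt0)//.
  by rewrite andbT; lra.
by rewrite rE /w; field; rewrite nz_Et nz_tau.
Qed.

Lemma relaxation_choice_sound (sigma delta : R) :
  (case1 rt En \/ case2 rt En \/ case3 tau rt kt Et En -> 0 < kn) ->
  relaxation_choice tau rt kt kn Et En sigma delta ->
  let r := sigma * rt + (1 - sigma) * En in
  [/\ Gamma tau rt kt kn Et En delta sigma, 0 <= delta * kn,
      r <= En & r = En \/ delta = 0].
Proof.
move=> kn_gt0 [c1 c2 c3 c4] r.
have w_ge0 : 0 <= w by rewrite !mulr_ge0 ?invr_ge0// ltW.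
have [stop|[kn_pos reach [sigma0 deltaE]]] : case4 tau rt kt Et En \/
    [/\ 0 < kn, 0 <= rt - En + w & sigma = 0 /\
        delta = (rt - En) / (tau * kn) + (rt * kt) / (Et * kn)].
- have [rtEn|Enrt|rtE] := ltgtP rt En.
  + have [reach|short] := leP 0 (rt - En + w); last by left.
    by right; split; [apply: kn_gt0; right; right|by []|exact: c3].
  + right; split; [by apply: kn_gt0; right; left| |exact: c2].
    by rewrite addr_ge0// subr_ge0 ltW.
  + right; split; first by apply: kn_gt0; left.
      by rewrite rtE subrr add0r.
    (* The two formulas for delta agree since the first quotient vanishes. *)
    by have [-> ->] := c1 rtE; rewrite rtE subrr mul0r add0r.
- have [sigmaE delta0] := c4 stop.
  have [inG rlt] := relaxation_stops_short stop.
  rewrite /r sigmaE delta0 mul0r; split => //; last by right.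
  exact: ltW.
- have [inG delta_ge0] := relaxation_reaches_energy kn_pos reach.
  rewrite -deltaE in inG delta_ge0.
  rewrite /r sigma0 mul0r add0r subr0 mul1r; split => //; last by left.
  by rewrite mulr_ge0// ltW.
Qed.

End Choice.
End ScalarRelaxation.

Theorem theorem2p1 (R : realType) (d : nat) (hd : d = 2%N \/ d = 3%N)
  (P : model R d) (S : R) (hS : 0 <= S)
  (k : nat) (hk : (1 <= k <= 4)%N)
  (t : int -> R) (ht : {homo t : i j / i < j})
  (phi p : int -> 'rV[R]_d -> R) (u : int -> 'rV[R]_d -> 'rV[R]_d)
  (r : nat -> R) (n : nat) (s : stage R d) (sigma delta : R)
  (hdata : regular_data P k n phi u)
  (hstage : regular_stage P k t n phi s)
  (hstep1 : step1 P S k t n phi u (r n) s)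
  (hupdate : update P k n phi u p s) :
  let tau := tau t n in
  let rt := tr s in
  let Et := energy1 P (tphi s) in
  let kt := kappa P (tphi s) (tu s) in
  let En := energy1 P (phi n.+1%:Z) in
  let kn := kappa P (phi n.+1%:Z) (u n.+1%:Z) in
  finite_integrals P (tphi s) (tu s) ->
  finite_integrals P (phi n.+1%:Z) (u n.+1%:Z) ->
  0 < Et ->
  (case1 rt En \/ case2 rt En \/ case3 tau rt kt Et En -> 0 < kn) ->
  relaxation_choice tau rt kt kn Et En sigma delta ->
  r n.+1 = sigma * rt + (1 - sigma) * En ->
  0 <= r n ->
  [/\ sigma \in Gamma tau rt kt kn Et En delta,
      0 <= r n.+1 /\ 0 <= xi P s,
      r n.+1 - r n = - (tau * delta * kn) /\ - (tau * delta * kn) <= 0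
    & r n.+1 <= En].
Proof.
move=> tau rt Et kt En kn _ _ Et_gt0 kn_gt0 choice rE rn_ge0.
have tau_gt0 : 0 < tau by rewrite subr_gt0; apply: ht; rewrite ltz_nat.
have kt_ge0 : 0 <= kt by exact: kappa_ge0.
have euler := step1_r hstep1.
have rt_ge0 : 0 <= rt by exact: (implicit_euler_ge0 _ _ _ _ _ _ _ _ _ euler).
have [inG Dge0 rle rdich] :
    [/\ Gamma tau rt kt kn Et En delta sigma, 0 <= delta * kn,
      sigma * rt + (1 - sigma) * En <= En
    & sigma * rt + (1 - sigma) * En = En \/ delta = 0].
  exact: relaxation_choice_sound kn_gt0 choice.
rewrite -rE in rle rdich.
have rstep : r n.+1 - r n = - (tau * (delta * kn)).
  by apply: (relaxation_telescope _ _ _ _ _ _ tau_gt0 euler); rewrite rE; case: inG.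
split => //.
- exact/mem_set.
- split; last by rewrite divr_ge0// ltW.
  case: rdich => [->|delta0]; first exact: energy1_ge0.
  by rewrite -[r n.+1](subrK (r n)) rstep delta0 mul0r mulr0 oppr0 add0r.
- by rewrite -mulrA oppr_le0; split => //; rewrite mulr_ge0// ltW.
Qed.
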